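(* Let $G$ be a finite non-abelian group with centre $Z(G)$ such that $G/Z(G)\cong Z_p\times Z_p$, where $p$ is a prime. Then the commuting conjugacy class graph $\Gamma(G)$ is not CN-hyperenergetic.
   Context: $Z_p$ denotes the cyclic group of order $p$. For a finite non-abelian group $G$, the commuting conjugacy class graph $\Gamma(G)$ is the simple undirected graph whose vertices are the conjugacy classes of the non-central elements of $G$; two distinct vertices $a^G$ and $b^G$ are adjacent if there exist $a'\in a^G$, $b'\in b^G$ with $a'b'=b'a'$. For a finite simple graph $\mathcal{G}$ with vertices $v_1,\dots,v_N$, the common neighbourhood matrix $CN(\mathcal{G})$ is the $N\times N$ matrix whose $(i,j)$ entry is, for $i\ne j$, the number of vertices other than $v_i,v_j$ adjacent to both $v_i$ and $v_j$, and is $0$ for $i=j$. The CN-energy $E_{CN}(\mathcal{G})$ is the sum of the absolute values of the eigenvalues of $CN(\mathcal{G})$, counted with multiplicity. With $K_N$ the complete graph on $N=|V(\mathcal{G})|$ vertices, $\mathcal{G}$ is CN-hyperenergetic if $E_{CN}(\mathcal{G})>E_{CN}(K_N)$. *)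

(* Defs.v *)
From HB Require Import structures.
From mathcomp Require Import all_boot all_order all_fingroup all_algebra.
From mathcomp Require Import all_solvable all_field.

Set Implicit Arguments.
Unset Strict Implicit.
Unset Printing Implicit Defensive.

Import Order.TTheory GRing.Theory Num.Theory.

Local Open Scope ring_scope.

Record sgraph := SGraph {
  vertex :> finType;
  adj : rel vertex;
  adj_sym : symmetric adj;
  adj_irr : irreflexive adj
}.

Definition complete_rel (N : nat) : rel 'I_N := fun i j => i != j.

Lemma complete_rel_sym N : symmetric (@complete_rel N).
Proof. by move=> i j; rewrite /complete_rel eq_sym. Qed.

Lemma complete_rel_irr N : irreflexive (@complete_rel N).
Proof. by move=> i; rewrite /complete_rel eqxx. Qed.

Definition complete_graph (N : nat) : sgraph :=
  SGraph (@complete_rel_sym N) (@complete_rel_irr N).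

Definition common_nbrs (Gr : sgraph) (u v : Gr) : {set Gr} :=
  [set w : Gr | [&& w != u, w != v, adj w u & adj w v]].

Definition CN_matrix (Gr : sgraph) : 'M[algC]_#|Gr| :=
  \matrix_(i, j)
    if i == j then 0 else #|common_nbrs (enum_val i) (enum_val j)|%:R.

(* The roots of the characteristic polynomial, repeated with their algebraic
   multiplicity; for the integer matrices used here they all lie in algC. *)
Definition eigenvalues (n : nat) (A : 'M[algC]_n) : seq algC :=
  sval (closed_field_poly_normal (char_poly A)).

Definition CN_energy (Gr : sgraph) : algC :=
  \sum_(l <- eigenvalues (CN_matrix Gr)) `|l|.

(* The order of algC is partial, but both energies are real. *)
Definition CN_hyperenergetic (Gr : sgraph) : Prop :=
  CN_energy (complete_graph #|Gr|) < CN_energy Gr.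

Section CommutingConjugacyClassGraph.

Variables (gT : finGroupType) (G : {group gT}).

Definition noncentral_classes : {set {set gT}} :=
  [set (a ^: G)%g | a in G :\: 'Z(G)%g].

Definition ccc_vertex : finType := {C : {set gT} | C \in noncentral_classes}.

Definition ccc_rel : rel ccc_vertex := fun C D =>
  (C != D) &&
  [exists a in val C, exists b in val D, (a * b == b * a)%g].

Lemma ccc_rel_sym : symmetric ccc_rel.
Proof.
move=> C D; rewrite /ccc_rel eq_sym; congr (_ && _).
by apply/exists_inP/exists_inP => -[a Ca /exists_inP[b Db /eqP ab]];
  exists b => //; apply/exists_inP; exists a => //; apply/eqP.
Qed.

Lemma ccc_rel_irr : irreflexive ccc_rel.
Proof. by move=> C; rewrite /ccc_rel eqxx. Qed.

Definition ccc_graph : sgraph := SGraph ccc_rel_sym ccc_rel_irr.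

End CommutingConjugacyClassGraph.

(* Main.v *)
Require Import Defs.
From mathcomp Require Import all_boot all_order all_fingroup all_algebra.
From mathcomp Require Import all_solvable all_field.

(** Since [G / 'Z(G)] has order [p ^ 2], the centralizer of a noncentral
    element is a proper subgroup containing the centre, hence is cyclic modulo
    the centre and abelian ([abelian_cent1_of_index_p2]).  Two elements that
    commute with a given noncentral one therefore commute with each other, and
    this passes to conjugacy classes: being equal or adjacent is transitive in
    the commuting conjugacy class graph ([ccc_adjeq_trans]), which is thus a
    disjoint union of complete graphs, its clusters.

    No disjoint union of complete graphs is CN-hyperenergetic, whatever the
    sizes of the clusters ([cluster_not_CN_hyperenergetic]), and a lower bound
    on the eigenvalues is enough for the comparison.  Let [N] be the number of
    vertices, the energies being 0 when [N <= 1].  On a cluster of size [m] the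
    eigenvalues of the common neighbourhood matrix are [(m - 1)(m - 2)] and,
    for [m >= 2], [- (m - 2)], so all of them are at least [- (N - 2)] once
    [N >= 2].  They add up to the trace, which is 0; so the sum of their
    absolute values is twice the total absolute value of the negative ones.  At
    least one of the [N] eigenvalues is nonnegative, whence the energy is at
    most [2 (N - 1)(N - 2)].  Conversely [(N - 1)(N - 2)] is an eigenvalue of
    the complete graph on [N] vertices, and the other ones must compensate it,
    so that the energy of that graph is at least [2 (N - 1)(N - 2)]. *)

(** * The spectrum of a matrix *)

Section Eigenvalues.

Import Order.TTheory GRing.Theory Num.Theory.
Local Open Scope ring_scope.

Variables (n : nat) (A : 'M[algC]_n).

Lemma char_poly_eigenvalues :
  char_poly A = \prod_(z <- eigenvalues A) ('X - z%:P).
Proof.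
rewrite /eigenvalues; case: closed_field_poly_normal => s /= {1}->.
by rewrite (monicP (char_poly_monic A)) scale1r.
Qed.

Lemma size_eigenvalues : size (eigenvalues A) = n.
Proof.
by apply: succn_inj; rewrite -(size_char_poly A) char_poly_eigenvalues
  size_prod_XsubC.
Qed.

Lemma mem_eigenvalues a : (a \in eigenvalues A) = eigenvalue A a.
Proof.
by rewrite eigenvalue_root_char char_poly_eigenvalues root_prod_XsubC.
Qed.

Lemma sum_eigenvalues : \sum_(z <- eigenvalues A) z = \tr A.
Proof.
have [n0 | n_gt0] := posnP n.
  rewrite [eigenvalues A]size0nil ?size_eigenvalues // big_nil /mxtrace big1 //.
  by move=> [i lt_in]; exfalso; rewrite n0 in lt_in.
apply: oppr_inj; rewrite -(char_poly_trace _ n_gt0) char_poly_eigenvalues.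
have sz := size_eigenvalues.
have ->: n.-1 = (size (eigenvalues A)).-1 by rewrite sz.
by rewrite coefPn_prod_XsubC // sz -lt0n.
Qed.

End Eigenvalues.

(** * Absolute values in families with zero sum *)

Section ZeroSumSequences.

Import Order.TTheory GRing.Theory Num.Theory.
Local Open Scope ring_scope.

Variables (R : numDomainType) (s : seq R).
Hypothesis sum0 : \sum_(x <- s) x = 0.

(** The other terms add up to [- x], so their absolute values contribute at
    least [`|x|] as well. *)
Lemma zero_sum_norm_ge x : x \in s -> `|x| *+ 2 <= \sum_(y <- s) `|y|.
Proof.
move=> sx; rewrite mulr2n (big_rem x sx) /= lerD2l.
have {1}->: x = - \sum_(y <- rem x s) y.
  by apply/eqP; rewrite -addr_eq0 -(big_rem x (P := predT)) // sum0.
by rewrite normrN ler_norm_sum.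
Qed.

(** Each term satisfies [`|x| <= x + 2 c], and a nonnegative one, which exists
    in a nonempty family of sum 0, needs no correction: this saves one of the
    [size s] corrections, which is what makes the bound match the energy of a
    complete graph. *)
Lemma zero_sum_norm_le c : 0 <= c -> {in s, forall x, - c <= x} ->
  \sum_(x <- s) `|x| <= c *+ 2 *+ (size s).-1.
Proof.
move=> c_ge0 s_ge; have s_real x : x \in s -> x \is Num.real.
  by move=> /s_ge/ger_real ->; rewrite rpredN ger0_real.
have norm_le x : x \in s -> `|x| <= x + c *+ 2.
  move=> /s_ge; rewrite -subr_ge0 opprK => xc_ge0.
  (* The order is partial, so the bound goes through x = (x + c) - c. *)
  rewrite -{1}(addrK c x) (le_trans (ler_normB _ _)) //.
  by rewrite (ger0_norm xc_ge0) (ger0_norm c_ge0) mulr2n addrA.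
have [s0 | [x0 sx0]] : s = [::] \/ exists x0, x0 \in s.
- by case: (s) => [|x t]; [left | right; exists x; rewrite mem_head].
- by rewrite s0 big_nil.
have [/hasP[x sx x_ge0] | /hasPn s_lt0] := boolP (has (>= 0) s); last first.
  have lt0 y : y \in s -> y < 0.
    by move=> sy; rewrite (real_ltNge (s_real _ sy) (rpred0 _)); apply: s_lt0.
  suff: \sum_(x <- s) x < 0 by rewrite sum0 ltxx.
  rewrite (big_rem x0 sx0) /= -[ltRHS]addr0 ltr_leD ?lt0 // big_seq.
  by apply: sumr_le0 => y /mem_rem/lt0/ltW.
(* The sum of s, which is 0, is added on the right so that the bound can be
   proved term by term once x has been cancelled. *)
rewrite (big_rem x sx) /= (ger0_norm x_ge0) -(size_rem sx).
rewrite -[leRHS]add0r -[X in _ <= X + _]sum0.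
rewrite [in leRHS](big_rem x sx) /= -addrA lerD2l.
have ->: c *+ 2 *+ size (rem x s) = \sum_(y <- rem x s) c *+ 2.
  by rewrite big_const_seq count_predT iter_addr_0.
rewrite -big_split /= big_seq [leRHS]big_seq.
by apply: ler_sum => y /mem_rem/norm_le.
Qed.

End ZeroSumSequences.

(** * Disjoint unions of complete graphs *)

Section ClusterGraphs.

Import Order.TTheory GRing.Theory Num.Theory.
Local Open Scope ring_scope.

Variable Gr : sgraph.

Definition adjeq : rel Gr := fun u v => (u == v) || adj u v.

Definition cluster (u : Gr) : {set Gr} := [set v | adjeq u v].

(** Indexed by vertices rather than by their ranks, so that sums over clusters
    can be written directly. *)
Definition CN (u v : Gr) : algC :=
  if u == v then 0 else #|common_nbrs u v|%:R.

Lemma mxtrace_CN_matrix : \tr (CN_matrix Gr) = 0.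
Proof. by rewrite /mxtrace big1 // => i _; rewrite mxE eqxx. Qed.

Lemma eigenvalue_CN_matrixP a :
  eigenvalue (CN_matrix Gr) a <->
  exists2 f : Gr -> algC, forall v, \sum_u f u * CN u v = a * f v
                        & exists v, f v != 0.
Proof.
have mulCN (w : 'rV_#|Gr|) j : (w *m CN_matrix Gr) 0 j =
    \sum_(u : Gr) w 0 (enum_rank u) * CN u (enum_val j).
  rewrite mxE (reindex (@enum_val Gr Gr)) /=; last first.
    by apply: onW_bij; apply: enum_val_bij.
  apply: eq_bigr => i _.
  by rewrite enum_valK mxE /CN (inj_eq enum_val_inj).
split=> [/eigenvalueP[w wA w_neq0] | [f fA [v fv]]].
  exists (fun u => w 0 (enum_rank u)).
    by move=> v; have := mulCN w (enum_rank v); rewrite enum_rankK wA mxE => <-.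
  by have [j wj] := rV0Pn _ w_neq0; exists (enum_val j); rewrite enum_valK.
apply/eigenvalueP; exists (\row_j f (enum_val j)).
  apply/rowP=> j; rewrite mulCN !mxE -fA; apply: eq_bigr => u _.
  by rewrite mxE enum_rankK.
by apply/rV0Pn; exists (enum_rank v); rewrite mxE enum_rankK.
Qed.

Hypothesis adjeq_trans : transitive adjeq.

Lemma adjeq_sym : symmetric adjeq.
Proof. by move=> u v; rewrite /adjeq eq_sym adj_sym. Qed.

Lemma mem_cluster v : v \in cluster v.
Proof. by rewrite inE /adjeq eqxx. Qed.

Lemma cluster_eq u v : u \in cluster v -> cluster u = cluster v.
Proof.
rewrite inE => vu; apply/setP=> w; rewrite !inE.
by apply/idP/idP; apply: adjeq_trans; rewrite // adjeq_sym.
Qed.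

Lemma card_common_nbrs u v : u != v ->
  #|common_nbrs u v| = if u \in cluster v then (#|cluster v| - 2)%N else 0%N.
Proof.
move=> neq_uv; case: ifP => [vu | vu].
  have ->: common_nbrs u v = cluster v :\ u :\ v.
    apply/setP=> w; have := cluster_eq _ _ vu => /setP/(_ w).
    rewrite !inE /adjeq ![_ == w]eq_sym ![adj _ w]adj_sym.
    by case: (eqVneq w v); case: (eqVneq w u) => //= _ _ ->; rewrite andbb.
  rewrite (cardsD1 u (cluster v)) vu (cardsD1 v (cluster v :\ u)).
  by rewrite in_setD1 mem_cluster eq_sym neq_uv addnA addKn.
apply/eqP; rewrite cards_eq0; apply/set0Pn=> -[w].
rewrite inE => /and4P[_ _ wu wv]; case/negP: (negbT vu); rewrite inE.
by apply: (adjeq_trans w); rewrite /adjeq ?wu ?[adj v _]adj_sym ?wv orbT.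
Qed.

(** The common neighbourhood matrix is block diagonal, the block of a cluster
    of size [m] being [m - 2] times (all-ones matrix - identity).  The
    truncated subtraction is harmless: for [m = 1] the second factor is 0. *)
Lemma sum_CN (f : Gr -> algC) v :
  \sum_u f u * CN u v =
    (#|cluster v| - 2)%:R * (\sum_(u in cluster v) f u - f v).
Proof.
rewrite (bigD1 v) //= {1}/CN eqxx mulr0 add0r.
rewrite (bigD1 v (mem_cluster v)) [X in _ * (X - _)]addrC addrK mulr_sumr.
rewrite [RHS]big_mkcondl; apply: eq_bigr => u neq_uv.
rewrite /CN (negPf neq_uv) card_common_nbrs //.
by case: ifPn => uv; [rewrite ifT // mulrC | rewrite ifN // mulr0].
Qed.

(** Take an eigenvector [f] for [a], a vertex [v] with [f v != 0], and let [m]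
    and [S] be the size of the cluster of [v] and the sum of [f] on it, so that
    [a * f u = (m - 2) * (S - f u)] on the cluster.  If [S = 0] the equation at
    [v] gives [a = - (m - 2)]; otherwise summing it over the cluster gives
    [a = (m - 2)(m - 1) >= 0]. *)
Lemma cluster_eigenvalue_ge a :
  eigenvalue (CN_matrix Gr) a -> - (#|Gr| - 2)%:R <= a.
Proof.
move=> /eigenvalue_CN_matrixP[f fA [v fv_neq0]].
have {}fA u : u \in cluster v ->
    a * f u = (#|cluster v| - 2)%:R * (\sum_(w in cluster v) f w - f u).
  by move=> uv; rewrite -fA sum_CN (cluster_eq _ _ uv).
set S := \sum_(w in cluster v) f w in fA.
have [S0 | S_neq0] := eqVneq S 0.
  have := fA v (mem_cluster v); rewrite S0 sub0r mulrN -mulNr.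
  move/(mulIf fv_neq0) ->; rewrite lerN2 ler_nat leq_sub2r //.
  exact: max_card.
have: a * S = (#|cluster v| - 2)%:R * (#|cluster v|%:R - 1) * S.
  rewrite mulr_sumr (eq_bigr _ fA) -mulr_sumr sumrB sumr_const -/S.
  by rewrite -mulrA mulrBl mul1r [_ * S]mulr_natl.
move/(mulIf S_neq0) ->; rewrite (@le_trans _ _ 0) ?oppr_le0 //.
rewrite mulr_ge0 // subr_ge0 ler1n card_gt0; apply/set0Pn.
by exists v; apply: mem_cluster.
Qed.

Lemma cluster_CN_energy_le :
  CN_energy Gr <= (#|Gr| - 2)%:R *+ 2 *+ #|Gr|.-1.
Proof.
rewrite /CN_energy -[in leRHS](size_eigenvalues _ (CN_matrix Gr)).
apply: zero_sum_norm_le; rewrite ?sum_eigenvalues ?mxtrace_CN_matrix //.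
rewrite size_eigenvalues.
by move=> a; rewrite mem_eigenvalues; apply: cluster_eigenvalue_ge.
Qed.

End ClusterGraphs.

(** * Comparison with the complete graph *)

Section ClusterVersusComplete.

Import Order.TTheory GRing.Theory Num.Theory.
Local Open Scope ring_scope.

(** The complete graph has a single cluster, on which the constant function is
    an eigenvector for [(N - 2)(N - 1)]. *)
Lemma complete_CN_energy_ge N :
  (N - 2)%:R *+ 2 *+ N.-1 <= CN_energy (complete_graph N).
Proof.
case: N => [|N]; first by rewrite mulr0n sumr_ge0.
set K := complete_graph N.+1.
have clT v : cluster K v = setT.
  by apply/setP=> u; rewrite !inE /adjeq /= /complete_rel; case: eqVneq.
have trK : transitive (adjeq K).
  by move=> u v w _ _; rewrite -[adjeq _ v w]in_set -/(cluster K v) clT inE.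
have ->: (N.+1 - 2)%:R *+ 2 *+ N.+1.-1 = `|(N.+1 - 2)%:R * N%:R| *+ 2 :> algC.
  by rewrite normrM !normr_nat mulr_natr mulrnAC.
apply: zero_sum_norm_ge; first by rewrite sum_eigenvalues mxtrace_CN_matrix.
rewrite mem_eigenvalues; apply/eigenvalue_CN_matrixP.
exists (fun=> 1); last by exists ord0; apply: oner_neq0.
move=> v; rewrite sum_CN // clT sumr_const cardsT card_ord mulr1.
by rewrite -[in LHS]natr1 addrK.
Qed.

Lemma cluster_not_CN_hyperenergetic (Gr : sgraph) :
  transitive (adjeq Gr) -> ~ CN_hyperenergetic Gr.
Proof.
move=> trGr; rewrite /CN_hyperenergetic => hyper.
have := le_trans (cluster_CN_energy_le _ trGr) (complete_CN_energy_ge _).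
by move/le_lt_trans/(_ hyper); rewrite ltxx.
Qed.

End ClusterVersusComplete.

(** * Centralizers and the commuting conjugacy class graph *)

Section CentralizersAndClasses.

Local Open Scope group_scope.

Variables (gT : finGroupType) (G : {group gT}).

(** By Lagrange the image of ['C_G[x]] in [G / 'Z(G)] has order 1, [p] or
    [p ^ 2]; the last case would make [x] central, and in the others ['C_G[x]]
    is cyclic modulo a central subgroup. *)
Lemma abelian_cent1_of_index_p2 p x : prime p -> #|G / 'Z(G)| = (p ^ 2)%N ->
  x \in G :\: 'Z(G) -> abelian 'C_G[x].
Proof.
move=> p_pr oGZ /setDP[Gx notZx].
have sZC : 'Z(G) \subset 'C_G[x].
  by rewrite subsetI center_sub sub_cent1 (subsetP _ x Gx) // centsC subsetIr.
have sCG : 'C_G[x] \subset G := subsetIl G _.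
have sZZ : 'Z(G) \subset 'Z('C_G[x]).
  rewrite subsetI sZC (subset_trans (subsetIr G 'C(G))) //.
  exact: centS.
apply: (cyclic_factor_abelian sZZ).
have: #|'C_G[x] / 'Z(G)| %| p ^ 2 by rewrite -oGZ cardSg ?quotientS.
case/(dvdn_pfactor _ _ p_pr) => [[|[|[|//]]]] _ oC.
- by rewrite (card1_trivg oC) cyclic1.
- by rewrite prime_cyclic // oC.
case/negP: notZx; rewrite inE Gx -sub_cent1.
suff: G \subset 'C_G[x] by rewrite subsetI => /andP[].
rewrite -(quotientSGK (normal_norm (center_normal G)) sZC).
rewrite (_ : 'C_G[x] / 'Z(G) = G / 'Z(G)) //.
by apply/eqP; rewrite eqEcard quotientS //= oC oGZ.
Qed.

Lemma ccc_vertexP (D : ccc_graph G) b :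
  b \in val D -> b \in G :\: 'Z(G) /\ val D = b ^: G.
Proof.
case: D => _ /= /imsetP[x nZx ->] xGb; split; last exact/esym/class_eqP.
case/imsetP: xGb => g Gg ->; case/setDP: nZx => Gx notZx.
rewrite in_setD (groupJ Gx Gg) andbT memJ_norm //.
exact: (subsetP (normal_norm (center_normal G))).
Qed.

Lemma ccc_adjeqP (C D : ccc_graph G) :
  reflect (exists a b, [/\ a \in val C, b \in val D & commute a b])
          (adjeq (ccc_graph G) C D).
Proof.
rewrite /adjeq /= /ccc_rel; apply: (iffP orP) => [[/eqP <-|/andP[_]] | ].
- have [x _ Cx] := imsetP (valP C).
  by exists x, x; rewrite Cx class_refl.
- by case/exists_inP=> a Ca /exists_inP[b Db /eqP ab]; exists a, b.
case=> a [b [Ca Db ab]]; case: eqVneq => [|_] /=; [by left | right].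
apply/exists_inP; exists a => //.
by apply/exists_inP; exists b => //; apply/eqP.
Qed.

(** If [a] commutes with [b] in the middle class and [c] with a conjugate of
    [b], then conjugating [c] lets both witnesses commute with the same [b], so
    that they lie in the abelian group ['C_G[b]]. *)
Lemma ccc_adjeq_trans :
  {in G :\: 'Z(G), forall x, abelian 'C_G[x]} ->
  transitive (adjeq (ccc_graph G)).
Proof.
move=> abC D C E /ccc_adjeqP[a [b [Ca Db ab]]] /ccc_adjeqP[b' [c [Db' Ec bc]]].
have [nZb defD] := ccc_vertexP _ _ Db.
have [/setDP[Ga _] _] := ccc_vertexP _ _ Ca.
have [/setDP[Gc _] defE] := ccc_vertexP _ _ Ec.
have /imsetP[g Gg def_b]: b \in b' ^: G.
  by have [_ <-] := ccc_vertexP _ _ Db'.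
apply/ccc_adjeqP; exists a, (c ^ g).
split=> //; first by rewrite defE memJ_class.
apply: (centsP (abC b nZb)).
  by rewrite in_setI Ga; apply/cent1P.
rewrite in_setI (groupJ Gc Gg); apply/cent1P.
by rewrite def_b /commute -!conjMg bc.
Qed.

End CentralizersAndClasses.

Theorem theorem3p8 (gT : finGroupType) (G : {group gT}) (p : nat)
    (p_pr : prime p) (nabG : ~~ abelian G)
    (isoGZ : (G / 'Z(G) \isog [set: 'Z_p * 'Z_p])%g) :
  ~ CN_hyperenergetic (ccc_graph G).
Proof.
have oGZ : #|(G / 'Z(G))%g| = (p ^ 2)%N.
  rewrite (card_isog isoGZ) cardsT card_prod !card_ord.
  by rewrite (Zp_cast (prime_gt1 p_pr)) mulnn.
apply: cluster_not_CN_hyperenergetic; apply: ccc_adjeq_trans => x.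
exact: abelian_cent1_of_index_p2 p_pr oGZ.
Qed.
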